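(* Let $k\ge 1$ and let $\mathcal{C}=\bigcap_{i=1}^k\mathcal{M}_i$ be the intersection of $k$ loopless matroids $\mathcal{M}_1,\dots,\mathcal{M}_k$ on the same finite ground set $V$. Then $\chi_\ell(\mathcal{C})\le k\,\chi(\mathcal{C})$.
   Context: A complex on a finite set $V$ is a non-empty family of subsets of $V$ closed under taking subsets; its members are called faces. A matroid is identified with the complex of its independent sets; loopless means that every singleton $\{v\}$, $v\in V$, is independent. The intersection $\bigcap_i\mathcal{M}_i$ is the complex of sets independent in all $\mathcal{M}_i$. The chromatic number $\chi(\mathcal{C})$ is the minimum number of faces of $\mathcal{C}$ whose union is $V$. Given sets (lists) $L_v$ of permissible colors for $v\in V$, a $\mathcal{C}$-respecting list coloring is a function $f:V\to\bigcup_{v}L_v$ with $f(v)\in L_v$ for every $v\in V$ and $f^{-1}(c)\in\mathcal{C}$ for every color $c$. The list chromatic number $\chi_\ell(\mathcal{C})$ is the minimum $p$ such that every system of lists $(L_v)_{v\in V}$ with $|L_v|=p$ for all $v$ has a $\mathcal{C}$-respecting list coloring. *)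

(* Defs.v *)
From mathcomp Require Import all_boot.
From mathcomp Require Import finmap.
From mathcomp Require Import boolp.

Set Implicit Arguments.
Unset Strict Implicit.
Unset Printing Implicit Defensive.

Local Open Scope nat_scope.

Record complex (V : finType) := Complex {
  faces :> {set {set V}};
  faces_neq0 : faces != set0;
  faces_sub : forall A B : {set V}, B \in faces -> A \subset B -> A \in faces
}.

Lemma set0_face (V : finType) (C : complex V) : set0 \in faces C.
Proof.
by have /set0Pn[A hA] := faces_neq0 C; apply: faces_sub hA (sub0set A).
Qed.

Record matroid (V : finType) := Matroid {
  indep :> complex V;
  indep_augment : forall A B : {set V}, A \in faces indep -> B \in faces indep ->
    #|A| < #|B| -> exists2 x, x \in B :\: A & x |: A \in faces indep
}.

Definition loopless (V : finType) (C : complex V) : Prop :=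
  forall v : V, [set v] \in faces C.

Lemma complex_cap_neq0 (V : finType) (k : nat) (C : 'I_k -> complex V) :
  \bigcap_(i < k) faces (C i) != set0.
Proof. by apply/set0Pn; exists set0; apply/bigcapP => i _; apply: set0_face. Qed.

Lemma complex_cap_sub (V : finType) (k : nat) (C : 'I_k -> complex V)
    (A B : {set V}) :
  B \in \bigcap_(i < k) faces (C i) -> A \subset B ->
  A \in \bigcap_(i < k) faces (C i).
Proof.
move=> /bigcapP BF AB; apply/bigcapP => i _.
by apply: (@faces_sub V (C i) A B); first exact: BF.
Qed.

Definition complex_cap (V : finType) (k : nat) (C : 'I_k -> complex V) :
  complex V := Complex (complex_cap_neq0 C) (@complex_cap_sub V k C).

(* The junk value 0 is returned only when no natural number satisfies P; by
   coverable_card and list_colorable_card below this never happens for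
   loopless complexes, in particular for intersections of loopless matroids. *)
Definition nat_min (P : nat -> Prop) : nat :=
  if pselect (exists n, `[< P n >]) is left exP then ex_minn exP else 0.

Lemma nat_minP (P : nat -> Prop) : (exists n, P n) ->
  P (nat_min P) /\ forall n, P n -> nat_min P <= n.
Proof.
move=> [n Pn]; rewrite /nat_min; case: pselect => [exP|[]]; last first.
  by exists n; apply/asboolP.
by case: ex_minnP => m /asboolP Pm minm; split=> // p /asboolP; apply: minm.
Qed.

Definition coverable (V : finType) (C : complex V) (n : nat) : Prop :=
  exists S : {set {set V}}, [/\ S \subset faces C, cover S = [set: V] & #|S| = n].

Definition chromatic_number (V : finType) (C : complex V) : nat :=
  nat_min (coverable C).

Definition respecting_list_coloring (V : finType) (C : complex V)
    (K : choiceType) (L : V -> {fset K}) (f : V -> K) : Prop :=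
  (forall v, f v \in L v) /\ (forall c : K, [set v | f v == c] \in faces C).

Definition list_colorable (V : finType) (C : complex V) (p : nat) : Prop :=
  forall (K : choiceType) (L : V -> {fset K}), (forall v, #|` L v| = p) ->
    exists f : V -> K, respecting_list_coloring C L f.

Definition list_chromatic_number (V : finType) (C : complex V) : nat :=
  nat_min (list_colorable C).

Lemma loopless_complex_cap (V : finType) (k : nat) (C : 'I_k -> complex V) :
  (forall i, loopless (C i)) -> loopless (complex_cap C).
Proof. by move=> CL v; apply/bigcapP => i _; apply: CL. Qed.

Lemma coverable_card (V : finType) (C : complex V) :
  loopless C -> coverable C #|V|.
Proof.
move=> CL; exists [set [set v] | v : V]; split.
- by apply/subsetP => _ /imsetP[v _ ->]; apply: CL.
- apply/setP => v; rewrite inE; apply/bigcupP; exists [set v]; rewrite ?set11 //.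
  exact: imset_f.
- by rewrite card_imset //; apply: set1_inj.
Qed.

Lemma list_colorable_card (V : finType) (C : complex V) :
  loopless C -> list_colorable C #|V|.
Proof.
move=> CL K L cardL.
suff [f fL finj] : exists2 f : V -> K, forall v, f v \in L v & injective f.
  exists f; split=> // c.
  have [/existsP[v /eqP <-]|/existsPn fc] := boolP [exists v, f v == c].
    by apply: faces_sub (CL v) _; apply/subsetP => w; rewrite !inE => /eqP/finj ->.
  by apply: faces_sub (set0_face C) _; apply/subsetP => w; rewrite inE (negPf (fc w)).
suff: forall s : seq V, uniq s -> exists2 f : V -> K,
    forall v, f v \in L v & {in s &, injective f}.
  move=> /(_ (enum V) (enum_uniq V)) [f fL finj]; exists f => // v w.
  by apply: finj; rewrite mem_enum.
elim=> [_|v s IHs /= /andP[vs us]].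
  have LV v : exists c, c \in L v.
    by apply/fset0Pn; rewrite -cardfs_gt0 cardL; apply/card_gt0P; exists v.
  by exists (fun v => xchoose (LV v)) => // v; apply: xchooseP.
have [f fL finj] := IHs us.
have [c cL cs] : exists2 c, c \in L v & c \notin map f s.
  apply/hasP; apply: contraT => /hasPn Ls.
  have: #|V| <= size (map f s).
    rewrite -(cardL v); apply: uniq_leq_size; first exact: fset_uniq.
    by move=> c /Ls; rewrite negbK.
  rewrite size_map leqNgt; case/negP.
  have /card_uniqP sE : uniq (v :: s) by rewrite /= vs.
  rewrite -[(size s).+1]/(size (v :: s)) -sE.
  exact: max_card.
exists (fun w => if w == v then c else f w).
  by move=> w; case: eqP => [->|].
move=> x y; rewrite !inE.
case: (eqVneq x v) => [->|_] /=; case: (eqVneq y v) => [->|_] //=.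
- by move=> _ ys cE; case/negP: cs; rewrite cE map_f.
- by move=> xs _ cE; case/negP: cs; rewrite -cE map_f.
- exact: finj.
Qed.

(* Main.v *)
Require Import Defs.
From mathcomp Require Import all_boot.
From mathcomp Require Import ssralg zmodp finmap.

(** Put C for the intersection of the k matroids and t for its chromatic number,
and let every list have size k * t. A list coloring respecting C is a choice of
one pair (v, c) with c in L_v for every v such that the chosen pairs form a face
of the complex D of those sets of pairs all of whose color classes are faces
of C. So a rainbow face of D is wanted, the pairs being partitioned by their
first coordinate.

Such a face is found by the topological form of Hall's theorem: it exists as
soon as, for every non-empty set A of vertices, the part D_A of D lying over A
has no reduced homology in dimension #|A| - 2 ([extendible_transversal]). The
argument is Sperner's lemma over the field with two elements. Vanishing of
homology permits to choose chains z_A of D_A, by induction on #|A|, with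
bd z_A = \sum_(a in A) z_(A \ a), so that the z_A imitate the faces of a simplex
on the vertices; counting facets modulo 2 then shows that z_A contains an odd
number of faces meeting every fibre over A ([sperner_chains_rainbow]).

Homology is controlled by an exchange property of C. A matroid is
1-extendible: a face B may absorb a new element v at the price of losing one
element, which can be taken outside any subset A of B compatible with v. Hence
C is k-extendible ([extendible_cap]), and so is D, because the exchange takes
place within one color class ([extendible_coloring]). A k-extendible complex
having a face S with more than k * n elements has no homology on its faces of
size n ([extendible_acyclic]): deleting points outside S keeps S, passing to the
link of such a point costs k elements of S and lowers n by one, and these two
complexes determine the homology by the Mayer-Vietoris argument; when only S
is left, the complex is a simplex.

It remains to find a face of D_A with at least k * #|A| elements. For each
color c, one of the t faces covering the ground set contains a fraction 1/t of
the vertices of A having c in their list. The union over c of these parts has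
at least 1/t times \sum_(v in A) #|L_v| = k * t * #|A| elements. *)

Set Implicit Arguments.
Unset Strict Implicit.
Unset Printing Implicit Defensive.

(** * Chains modulo 2 *)

Section Chains.

Import GRing.Theory.
Local Open Scope ring_scope.

Lemma addF2_self (x : 'F_2) : x + x = 0.
Proof. by apply: val_inj; case: x => [[|[|]]]. Qed.

Lemma add_selfK (V : zmodType) (hV : forall x : V, x + x = 0) (x y : V) :
  x + (x + y) = y.
Proof. by rewrite addrA hV add0r. Qed.

(** The pairs (a, b) and (b, a) cancel. This is the source of all the relations
of the form bd (bd z) = 0. *)
Lemma sum_sym_pairs (J : finType) (V : zmodType) (hV : forall x : V, x + x = 0)
    (P : pred J) (g : J -> J -> V) :
  (forall a b, g a b = g b a) ->
  \sum_(a | P a) \sum_(b | P b && (b != a)) g a b = 0.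
Proof.
move=> gC; pose lt (a b : J) := (enum_rank a < enum_rank b)%N.
have split a : \sum_(b | P b && (b != a)) g a b =
    \sum_(b | P b && lt a b) g a b + \sum_(b | P b && lt b a) g a b.
  rewrite (bigID (lt a)) /=; congr (_ + _); apply: eq_bigl => b; rewrite /lt.
    by case: eqVneq => [->|_]; rewrite ?ltnn ?andbF ?andbT.
  rewrite -andbA -leqNgt ltn_neqAle -(inj_eq enum_rank_inj) -(inj_eq val_inj) /=.
  by [].
under eq_bigr do rewrite split.
rewrite big_split /= [X in _ + X](exchange_big_dep P) /=; last by move=> ? ? _ /andP[].
rewrite -big_split /= big1 // => a Pa.
rewrite [X in _ + X](_ : _ = \sum_(b | P b && lt a b) g a b) ?hV //.
by apply: eq_big => [b|b _]; rewrite ?Pa // gC.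
Qed.

Variable W : finType.

(** A chain is the indicator function of a set of sets of vertices; the empty set
is allowed, so that homology below is always reduced homology. *)
Definition chain := {ffun {set W} -> 'F_2}.

Lemma chain_self (z : chain) : z + z = 0.
Proof. by apply/ffunP => T; rewrite !ffunE addF2_self. Qed.

Definition bd (z : chain) : chain :=
  [ffun T : {set W} => \sum_(w | w \notin T) z (w |: T)].

Definition cone (v : W) (z : chain) : chain :=
  [ffun T : {set W} => if v \in T then z (T :\ v) else 0].

(** [slice v z] is the component of [z] in the link of [v]: every chain is the sum
of a chain avoiding [v] and of [cone v (slice v z)]. *)
Definition slice (v : W) (z : chain) : chain :=
  [ffun T : {set W} => if v \in T then 0 else z (v |: T)].

Lemma bdD (y z : chain) : bd (y + z) = bd y + bd z.
Proof.
apply/ffunP => T; rewrite !ffunE -big_split /=.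
by apply: eq_bigr => w _; rewrite ffunE.
Qed.

Lemma bd0 : bd 0 = 0.
Proof. by apply/ffunP => T; rewrite !ffunE big1 // => w _; rewrite ffunE. Qed.

Lemma bd_sum (J : finType) (P : pred J) (z : J -> chain) :
  bd (\sum_(j | P j) z j) = \sum_(j | P j) bd (z j).
Proof. exact: (big_morph bd bdD bd0). Qed.

Lemma bd_bd (z : chain) : bd (bd z) = 0.
Proof.
apply/ffunP => T; rewrite !ffunE.
rewrite -[RHS](@sum_sym_pairs _ _ addF2_self (fun w => w \notin T)
  (fun a b => z (b |: (a |: T)))); last by move=> a b; rewrite setUCA.
apply: eq_bigr => a _; rewrite ffunE; apply: eq_bigl => b.
by rewrite !inE negb_or andbC.
Qed.

Lemma bd_cone (v : W) (z : chain) : bd (cone v z) = z + cone v (bd z).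
Proof.
apply/ffunP => T; rewrite !ffunE; case: ifPn => vT.
  rewrite [X in _ + X](bigD1 v) /= ?setD11 // setD1K // add_selfK //; last first.
    exact: addF2_self.
  apply: eq_big => w; first by rewrite !inE; case: eqVneq => [->|]; rewrite ?vT ?andbT.
  move=> wT; rewrite ffunE !inE vT orbT; congr (z _); apply/setP => x; rewrite !inE.
  case: (eqVneq x w) => [->|//]; rewrite andbT /=.
  by apply: contraNneq wT => ->.
rewrite (bigD1 v) //= ffunE setU11 setU1K // big1 // => w /andP[_ wv].
by rewrite ffunE !inE (negPf vT) orbF eq_sym (negPf wv).
Qed.

Lemma bd_slice (v : W) (z : chain) : bd (slice v z) = slice v (bd z).
Proof.
apply/ffunP => T; rewrite !ffunE; case: ifPn => vT.
  by rewrite big1 // => w _; rewrite ffunE !inE vT orbT.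
rewrite [LHS](bigD1 v) //= ffunE setU11 add0r.
apply: eq_big => w; first by rewrite !inE negb_or andbC.
move=> /andP[_ wv]; rewrite ffunE !inE (negPf vT) orbF eq_sym (negPf wv).
by rewrite setUCA.
Qed.

(** The set [F] plays the part of a face whose link is considered: for [X]
disjoint from [F], these are the chains of faces of size [n] of the link of [F],
restricted to [X]. *)
Definition supported (C : complex W) (F X : {set W}) (n : nat) (z : chain) : Prop :=
  forall T, z T != 0 -> [/\ #|T| = n, T \subset X & T :|: F \in C].

Lemma supportedW C (F F' X X' : {set W}) n z :
  F' \subset F -> X \subset X' -> supported C F X n z -> supported C F' X' n z.
Proof.
move=> FF XX zS T /zS[Tn TX TC]; split=> //; first exact: subset_trans XX.
by apply: faces_sub TC _; rewrite setUS.
Qed.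

Lemma supportedD C F X n y z :
  supported C F X n y -> supported C F X n z -> supported C F X n (y + z).
Proof.
move=> yS zS T; rewrite ffunE; case: (eqVneq (y T) 0) => [->|/yS //].
by rewrite add0r => /zS.
Qed.

Lemma supported_sum C F X n (J : finType) (P : pred J) (z : J -> chain) :
  (forall j, P j -> supported C F X n (z j)) ->
  supported C F X n (\sum_(j | P j) z j).
Proof.
move=> zS; elim/big_ind: _ => //; last exact: supportedD.
by move=> T; rewrite ffunE eqxx.
Qed.

Lemma supported_cone C (F X : {set W}) n v z : v \in X ->
  supported C (v |: F) (X :\ v) n z -> supported C F X n.+1 (cone v z).
Proof.
move=> vX zS T; rewrite ffunE; case: ifP => [vT|]; last by rewrite eqxx.
move=> /zS[Tn TX TC]; split.
- by rewrite (cardsD1 v) vT Tn.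
- by rewrite -(setD1K vT) subUset sub1set vX (subset_trans TX) ?subD1set.
- by rewrite setUCA setUA setD1K in TC.
Qed.

Lemma supported_slice C (F X : {set W}) n v z :
  supported C F X n.+1 z -> supported C (v |: F) (X :\ v) n (slice v z).
Proof.
move=> zS T; rewrite ffunE; case: ifPn => [|vT]; first by rewrite eqxx.
move=> /zS[]; rewrite cardsU1 vT add1n => -[Tn] TX TC; split=> //.
- by rewrite subsetD1 vT andbT (subset_trans _ TX) ?subsetUr.
- by rewrite setUCA setUA.
Qed.

(** * Homology of extendible complexes *)

(** This is the notion of a k-extendible system, known from the analysis of the
greedy algorithm. *)
Definition extendible (k : nat) (C : complex W) : Prop :=
  forall (A B : {set W}) (v : W), A \subset B -> B \in C -> v |: A \in C ->
    exists Z : {set W}, [/\ Z \subset B :\: A, (#|Z| <= k)%N & v |: (B :\: Z) \in C].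

(** The complex of interest is the link of [F] restricted to [X], and [S] is a
large face of it. Allowing an arbitrary [F] makes the statement stable under
passing to links, so that extendibility is only ever used for [C] itself. *)
Lemma extendible_acyclic k C (F X S : {set W}) n z :
  extendible k C -> [disjoint X & F] -> S \subset X -> S :|: F \in C ->
  (k * n < #|S|)%N -> supported C F X n z -> bd z = 0 ->
  exists2 y, supported C F X n.+1 y & bd y = z.
Proof.
move=> Cext; have [m] := ubnP #|X|.
elim: m => // m IHm in F X S n z * => Xm XF SX SC knS zS bz.
have [coneP|] := boolP ((n == 0) || (X \subset S)).
  have /card_gt0P[s sS] : (0 < #|S|)%N by apply: leq_ltn_trans knS.
  (* The faces involved all lie in S, so a cone with any apex s in S will do. *)
  exists (cone s z); last first.
    by rewrite bd_cone bz; apply/ffunP => T; rewrite !ffunE if_same addr0.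
  move=> T; rewrite ffunE; case: ifP => [sT|]; last by rewrite eqxx.
  move=> /zS[Tn TX TC].
  have TS : T :\ s \subset S.
    case/orP: coneP => [/eqP n0|]; last exact: subset_trans.
    by move/eqP: Tn; rewrite n0 cards_eq0 => /eqP ->; apply: sub0set.
  have {}TS : T \subset S by rewrite -(setD1K sT) subUset sub1set sS.
  split; first by rewrite (cardsD1 s) sT Tn.
    exact: subset_trans SX.
  by apply: faces_sub SC _; apply: setSU.
rewrite negb_or => /andP[n0 /subsetPn[v vX vS]].
have Xvm : (#|X :\ v| < m)%N by rewrite (cardsD1 v) vX in Xm.
have SXv : S \subset X :\ v by rewrite subsetD1 SX.
have XvF : [disjoint X :\ v & F] by apply: disjointWl XF; apply: subD1set.
have inXv n' (y : chain) : supported C F X n' y ->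
    (forall T : {set W}, v \in T -> y T = 0) -> supported C F (X :\ v) n' y.
  move=> yS yv T yT; have [Tn TX TC] := yS T yT; split=> //.
  by rewrite subsetD1 TX /=; apply: contraNN yT => /yv ->.
(* If v is a loop of the link of F, then deleting it changes nothing. *)
have [vF|vF] := boolP (v |: F \in C); last first.
  have [|y yS <-] := IHm F (X :\ v) S n z Xvm XvF SXv SC knS _ bz.
    apply: inXv => // T vT; apply/eqP; apply: contraNT vF => /zS[_ _ TC].
    by apply: faces_sub TC _; rewrite setSU // sub1set.
  by exists y => //; apply: supportedW yS; rewrite ?subD1set.
case: n n0 => // n _ in knS zS inXv *.
(* Fill the component of z in the link of v, where S loses the at most k
   elements of Z while n decreases by one. *)
have [Z [ZS Zk ZC]] := Cext F (S :|: F) v (subsetUr _ _) SC vF.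
have ZF : [disjoint Z & F] by move: ZS; rewrite subsetD => /andP[].
have [||||||y1 y1S by1] := IHm (v |: F) (X :\ v) (S :\: Z) n (slice v z) Xvm.
- rewrite disjoints_subset; apply/subsetP => x xXv; rewrite !inE negb_or.
  by rewrite (disjointFr XvF xXv) andbT; case/setD1P: xXv.
- by rewrite (subset_trans _ SXv) ?subsetDl.
- rewrite setUCA; apply: faces_sub ZC _; apply/setUS.
  by rewrite setDUl setUS // subsetD subxx disjoint_sym.
- rewrite -(ltn_add2l k) -mulnS (leq_trans knS) // -(cardsID Z S) leq_add2r.
  by rewrite (leq_trans _ Zk) // subset_leq_card // subsetIr.
- exact: supported_slice.
- by rewrite bd_slice bz; apply/ffunP => T; rewrite !ffunE if_same.
(* Correcting z by the boundary of cone v y1 pushes it off v; the resulting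
   cycle is filled in the deletion of v. *)
have [||y0 y0S by0] := IHm F (X :\ v) S n.+1 (z + bd (cone v y1)) Xvm XvF SXv SC knS.
- apply: inXv.
    rewrite bd_cone by1; apply: supportedD => //; apply: supportedD.
      by apply: supportedW y1S; rewrite ?subsetUr ?subD1set.
    by apply: supported_cone => //; apply: supported_slice.
  move=> T vT; rewrite bd_cone by1 !ffunE vT !inE eqxx /= setD1K //.
  have [->|/y1S[_ /subsetP/(_ v vT)]] := eqVneq (y1 T) 0; last by rewrite !inE eqxx.
  by rewrite add0r addF2_self.
- by rewrite bdD bz bd_bd addr0.
exists (y0 + cone v y1).
  apply: supportedD; last exact: supported_cone.
  by apply: supportedW y0S; rewrite ?subD1set.
by rewrite bdD by0 -addrA chain_self addr0.
Qed.

(** * A topological Hall theorem *)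

Variables (I : finType) (p : W -> I).

(** If [T] is rainbow, its only facet with image [A :\ a] omits the point over
[a]. Otherwise, if there is such a facet, two points of [T] have the same image,
and omitting either of them gives such a facet. *)
Lemma rainbow_facets (T : {set W}) (A : {set I}) (a : I) :
  a \in A -> #|T| = #|A| -> p @: T \subset A ->
  \sum_(w in T | p @: (T :\ w) == A :\ a) 1 = (p @: T == A)%:R :> 'F_2.
Proof.
move=> aA TA pTA.
have pD1 w : w \in T -> p @: T = p w |: p @: (T :\ w).
  by move=> wT; rewrite -imsetU1 setD1K.
have cardTD1 w : w \in T -> #|T :\ w| = #|A :\ a|.
  move=> wT; move: TA; rewrite (cardsD1 w T) (cardsD1 a A) wT aA.
  by case.
have [pT|npT] := eqVneq (p @: T) A.
  have pinj : {in T &, injective p} by apply/imset_injP; rewrite pT TA.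
  have /imsetP[v vT va] : a \in p @: T by rewrite pT.
  rewrite (big_pred1 v) // => w; apply/andP/eqP => [[wT /eqP pTw]|->].
    apply: (pinj) => //; apply/eqP; rewrite -va.
    apply: contraT => pwa; suff : p w \in p @: (T :\ w).
      case/imsetP => x; rewrite !inE => /andP[xw xT] /(pinj _ _ wT xT) wx.
      by rewrite wx eqxx in xw.
    by rewrite pTw !inE pwa -pT imset_f.
  split=> //; rewrite -pT va (pD1 v) // setU1K //.
  apply/imsetP => -[x]; rewrite !inE => /andP[xv xT] /(pinj _ _ vT xT) vx.
  by rewrite vx eqxx in xv.
case: (pickP (fun w => (w \in T) && (p @: (T :\ w) == A :\ a))) =>
    [w /andP[wT /eqP pTw]|noface]; last by rewrite big_pred0.
have pwa : p w != a.
  by apply: contraNneq npT => pwa; rewrite (pD1 w) // pTw pwa setD1K.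
have /imsetP[v] : p w \in p @: (T :\ w).
  by rewrite pTw !inE pwa (subsetP pTA) ?imset_f.
rewrite !inE => /andP[vw vT] pwv.
rewrite (bigD1 w) ?wT ?pTw ?eqxx //= (bigD1 v) /=; last first.
  rewrite vT vw andbT -pTw; apply/eqP/setP => b; apply/imsetP/imsetP => -[x].
    rewrite !inE => /andP[xv xT] ->.
    have [->|xw] := eqVneq x w; last by exists x; rewrite // !inE xw.
    by exists v; rewrite // !inE vw.
  rewrite !inE => /andP[xw xT] ->.
  have [->|xv] := eqVneq x v; last by exists x; rewrite // !inE xv.
  by exists w; rewrite // !inE eq_sym vw.
rewrite big_pred0 ?addr0 ?addF2_self // => x; apply/negbTE/negP.
case/andP => /andP[/andP[xT /eqP pTx] xw] xv.
have /imset_injP pinj : #|p @: (T :\ x)| == #|T :\ x| by rewrite pTx cardTD1.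
by case/eqP: vw; apply: pinj; rewrite // !inE eq_sym ?xv ?xw.
Qed.

Lemma rainbow_bd (z : chain) (A : {set I}) (a : I) : a \in A ->
  (forall T : {set W}, z T != 0 -> #|T| = #|A| /\ p @: T \subset A) ->
  \sum_(T : {set W} | p @: T == A :\ a) bd z T = \sum_(T : {set W} | p @: T == A) z T.
Proof.
move=> aA zA.
under eq_bigr do rewrite ffunE.
rewrite [RHS]big_mkcond /=.
transitivity (\sum_(T : {set W}) \sum_(w in T | p @: (T :\ w) == A :\ a) z T).
  rewrite (exchange_big_dep xpredT) //= [RHS](exchange_big_dep xpredT) //=.
  apply: eq_bigr => w _.
  rewrite (reindex_onto (fun T : {set W} => T :\ w) (fun T => w |: T)) /=; last first.
    by move=> T /andP[_ wT]; rewrite setU1K.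
  apply: eq_big => T.
    rewrite setD11 andbT andbC; congr (_ && _).
    by apply/eqP/idP => [<-|wT]; rewrite ?setU11 ?setD1K.
  by case/andP => _ /eqP ->.
apply: eq_bigr => T _.
have [z0|/zA[TA pTA]] := eqVneq (z T) 0; first by rewrite z0 big1 ?if_same.
under eq_bigr do rewrite -[z T]mul1r.
rewrite -mulr_suml rainbow_facets //.
by case: eqP; rewrite ?mul1r ?mul0r.
Qed.

Variables (k : nat) (C : complex W) (X : {set W}).

Definition over (A : {set I}) : {set W} := X :&: p @^-1: A.

Lemma overS (A B : {set I}) : A \subset B -> over A \subset over B.
Proof. by move=> AB; rewrite setIS ?preimsetS. Qed.

(** Up to size [n], the chains [z A] are the images of the faces [A] of the simplex
on [I] under a chain map that carries each [A] into the part of [C] over [A]. *)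
Definition sperner_chains (n : nat) (z : {set I} -> chain) : Prop :=
  z set0 set0 = 1 /\
  forall A : {set I}, (#|A| <= n)%N -> supported C set0 (over A) #|A| (z A) /\
    bd (z A) = \sum_(a in A) z (A :\ a).

(** Among the faces of size [#|A|.-1] in the boundary of [z A], those with image
[A :\ a] can only come from [z (A :\ a)], which gives the induction. *)
Lemma sperner_chains_rainbow n z (A : {set I}) : sperner_chains n z ->
  (#|A| <= n)%N -> \sum_(T : {set W} | p @: T == A) z A T = 1.
Proof.
move=> [z0 zA]; have suppA (B : {set I}) T :
    (#|B| <= n)%N -> z B T != 0 -> #|T| = #|B| /\ p @: T \subset B.
  move=> Bn; have [BS _] := zA B Bn; move=> /BS[TB TX _]; split=> //.
  by apply/subsetP => _ /imsetP[w /(subsetP TX) + ->]; rewrite !inE => /andP[].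
have [m] := ubnP #|A|; elim: m => // m IHm in A * => Am An.
have [->|[a aA]] := set_0Vmem A.
  by rewrite (big_pred1 set0) // => T; rewrite imset_eq0.
have Aa : (#|A :\ a| < #|A|)%N by rewrite [X in (_ < X)%N](cardsD1 a) aA.
rewrite -(@rainbow_bd _ A a) //; last by move=> T; apply: suppA.
have [_ ->] := zA A An.
under eq_bigr do rewrite sum_ffunE.
rewrite exchange_big (bigD1 a) //= IHm; first last.
- exact: ltnW (leq_trans Aa An).
- exact: leq_trans Aa Am.
rewrite big1 ?addr0 // => b /andP[bA ba].
rewrite big1 // => T /eqP pT.
apply/eqP; apply: contraT => /suppA[|_].
  by rewrite (leq_trans _ An) // subset_leq_card // subD1set.
by rewrite pT => /subsetP/(_ b); rewrite !inE ba bA eqxx => /(_ isT).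
Qed.

(** The sum of the chains [z (A :\ a)] is a cycle by the same cancellation as in
[bd_bd], and the hypothesis on [A] is what [extendible_acyclic] requires to fill
it over [A]. *)
Lemma sperner_chains_exist : extendible k C ->
  (forall A : {set I}, A != set0 ->
     exists S, [/\ S \in C, S \subset over A & (k * #|A|.-1 < #|S|)%N]) ->
  forall n, exists z, sperner_chains n z.
Proof.
move=> Cext bigS; elim=> [|n [z [z0 zA]]].
  exists (fun=> [ffun T => (T == set0)%:R]); split; first by rewrite ffunE eqxx.
  move=> A; rewrite leqn0 cards_eq0 => /eqP ->; split.
    move=> T; rewrite ffunE; have [-> _|] := eqVneq T set0; last by rewrite eqxx.
    by split; rewrite ?cards0 ?sub0set ?setU0 ?set0_face.
  rewrite big_set0; apply/ffunP => T; rewrite !ffunE big1 // => w _.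
  by rewrite ffunE; case: eqP => // /setP/(_ w); rewrite !inE eqxx.
have fill (A : {set I}) : exists y, #|A| = n.+1 -> supported C set0 (over A) n.+1 y /\
    bd y = \sum_(a in A) z (A :\ a).
  have [An|] := eqVneq #|A| n.+1; last by move/eqP=> An; exists 0.
  have A0 : A != set0 by rewrite -cards_eq0 An.
  have [S [SC SA]] := bigS A A0; rewrite An => /= knS.
  have AD1 a : a \in A -> #|A :\ a| = n.
    by move=> aA; move: An; rewrite (cardsD1 a) aA => -[].
  have [||||y yS <-] := @extendible_acyclic k C set0 (over A) S n
      (\sum_(a in A) z (A :\ a)) Cext _ SA _ knS; last by exists y => _.
  - by rewrite -setI_eq0 setI0.
  - by rewrite setU0.
  - apply: supported_sum => a aA; rewrite -(AD1 a aA).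
    have [] := zA (A :\ a); first by rewrite AD1.
    by move=> + _; apply: supportedW => //; apply/overS/subD1set.
  - rewrite bd_sum -[RHS](@sum_sym_pairs _ _ chain_self (mem A)
      (fun a b => z (A :\ a :\ b))); last by move=> a b; rewrite !setDDl setUC.
    apply: eq_bigr => a aA; have [_ ->] := zA (A :\ a) (eq_leq (AD1 a aA)).
    by apply: eq_bigl => b; rewrite !inE andbC.
have [y yP] := fin_all_exists fill.
exists (fun A : {set I} => if #|A| == n.+1 then y A else z A); split.
  by rewrite cards0.
move=> A; rewrite leq_eqVlt ltnS => /orP[/eqP An|An].
  rewrite An eqxx; have [yS ->] := yP A An; split=> //.
  apply: eq_bigr => a aA.
  have -> : #|A :\ a| = n by move: An; rewrite (cardsD1 a) aA => -[].
  by rewrite eqn_leq ltnn andbF.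
have lt B : (#|B| <= n)%N -> (#|B| == n.+1) = false.
  by move=> Bn; apply/eqP => BE; rewrite BE ltnn in Bn.
rewrite lt //; have [zS ->] := zA A An; split=> //.
apply: eq_bigr => a aA; rewrite lt // (leq_trans _ An) //.
by rewrite subset_leq_card ?subD1set.
Qed.

Theorem extendible_transversal : extendible k C ->
  (forall A : {set I}, A != set0 ->
     exists S, [/\ S \in C, S \subset over A & (k * #|A|.-1 < #|S|)%N]) ->
  exists T, [/\ T \in C, T \subset X & p @: T = setT].
Proof.
move=> Cext bigS; have [z zP] := sperner_chains_exist Cext bigS #|I|.
have cardT : (#|[set: I]| <= #|I|)%N by rewrite cardsT.
have odd_rainbow := sperner_chains_rainbow zP cardT.
have [T pT zT] : exists2 T : {set W}, p @: T == setT & z setT T != 0.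
  apply/exists_inP; apply: contraT => /exists_inPn no.
  move: odd_rainbow; rewrite big1 // => T pT; apply/eqP.
  by have := no T pT; rewrite negbK.
have [_ /(_ _ cardT)[zS _]] := zP; have [_ TX TC] := zS T zT.
exists T; split; [by rewrite setU0 in TC| |exact/eqP].
by apply: subset_trans TX _; apply: subsetIl.
Qed.

End Chains.

(** * Extendibility of intersections of matroids and of coloring complexes *)

(** Augment [v |: A] inside [v |: B] as long as possible: the outcome has at least
as many elements as [B], so it omits at most one element of [v |: B]. *)
Lemma matroid_extendible (V : finType) (M : matroid V) : extendible 1 M.
Proof.
move=> A B v AB BM vAM.
have [vB|vB] := boolP (v \in B).
  exists set0; split; rewrite ?sub0set ?cards0 // setD0.
  by rewrite (setUidPr _) ?sub1set.
pose P (J : {set V}) := (J \in faces M) && (J \subset v |: B).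
have [J /maxsetP[/andP[JM JvB] Jmax] vAJ] : {J | maxset P J & v |: A \subset J}.
  by apply: maxset_exists; rewrite /P vAM setUS.
have cardJ : #|B| <= #|J|.
  rewrite leqNgt; apply/negP => JB.
  have [x /setDP[xB xJ] xJM] := indep_augment JM BM JB.
  case/negP: xJ; rewrite -(Jmax (x |: J)) ?setU11 ?subsetUr //.
  by rewrite /P xJM subUset JvB sub1set !inE xB orbT.
have vJ : v \in J by rewrite (subsetP vAJ) ?setU11.
have AJ : A \subset J by apply: subset_trans vAJ; apply: subsetUr.
exists ((v |: B) :\: J); split.
- apply/subsetP => x; rewrite !inE => /andP[xJ].
  case: eqVneq => [xv|_ /= ->]; first by rewrite xv vJ in xJ.
  by rewrite andbT; apply: contraNN xJ; apply: (subsetP AJ).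
- by rewrite cardsDS // cardsU1 vB leq_subLR addnC leq_add2r.
- apply: faces_sub JM _; apply/subsetP => x; rewrite !inE negb_and negbK.
  case: eqVneq => [-> //|_ /=]; case: (x \in J) => //=.
  by case: (x \in B).
Qed.

Lemma leq_card_bigcup (J T : finType) (P : pred J) (F : J -> {set T}) :
  #|\bigcup_(j | P j) F j| <= \sum_(j | P j) #|F j|.
Proof.
elim/big_rec2: _ => [|j m B _ Bm]; first by rewrite cards0.
by rewrite (leq_trans (leq_card_setU _ _)) // leq_add2l.
Qed.

Lemma extendible_cap (V : finType) (k : nat) (C : 'I_k -> complex V) :
  (forall i, extendible 1 (C i)) -> extendible k (complex_cap C).
Proof.
move=> Cext A B v AB /bigcapP BC /bigcapP vAC.
have [Z ZP] := fin_all_exists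
  (fun i => Cext i A B v AB (BC i isT) (vAC i isT)).
exists (\bigcup_i Z i); split.
- by apply/bigcupsP => i _; have [] := ZP i.
- apply: leq_trans (leq_card_bigcup xpredT Z) _.
  rewrite -[X in _ <= X]card_ord -sum1_card; apply: leq_sum => i _.
  by have [] := ZP i.
- apply/bigcapP => i _; have [_ _ ZC] := ZP i; apply: faces_sub ZC _.
  by rewrite setUS // setDS // bigcup_sup.
Qed.

Section Colors.

Variables (V E : finType) (C : complex V).

Definition color_class (T : {set V * E}) (c : E) : {set V} :=
  [set v | (v, c) \in T].

Definition colored_faces : {set {set V * E}} :=
  [set T | [forall c, color_class T c \in faces C]].

Lemma colored_faces_neq0 : colored_faces != set0.
Proof.
apply/set0Pn; exists set0; rewrite inE; apply/forallP => c.
by apply: faces_sub (set0_face C) _; apply/subsetP => v; rewrite !inE.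
Qed.

Lemma colored_faces_sub (A B : {set V * E}) :
  B \in colored_faces -> A \subset B -> A \in colored_faces.
Proof.
rewrite !inE => /forallP BC AB; apply/forallP => c.
by apply: faces_sub (BC c) _; apply/subsetP => v; rewrite !inE; apply: (subsetP AB).
Qed.

(** The join of copies of [C], one for each color in [E]. *)
Definition coloring_complex : complex (V * E)%type :=
  Complex colored_faces_neq0 colored_faces_sub.

Lemma extendible_coloring k : extendible k C -> extendible k coloring_complex.
Proof.
move=> Cext A B [u c] AB; rewrite !inE => /forallP BC /forallP uAC.
have [|||Z [ZB Zk ZC]] := Cext (color_class A c) (color_class B c) u.
- by apply/subsetP => v; rewrite !inE; apply: (subsetP AB).
- exact: BC.
- apply: faces_sub (uAC c) _; apply/subsetP => v; rewrite !inE.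
  by rewrite xpair_eqE eqxx andbT.
exists (setX Z [set c]); split; last 1 first.
- rewrite inE; apply/forallP => d; have [->|dc] := eqVneq d c.
    apply: faces_sub ZC _; apply/subsetP => v; rewrite !inE.
    by rewrite xpair_eqE eqxx !andbT.
  apply: faces_sub (BC d) _; apply/subsetP => v; rewrite !inE.
  by rewrite xpair_eqE (negPf dc) !andbF.
- apply/subsetP => -[v d] /setXP[/(subsetP ZB) /= + /set1P ->].
  by rewrite !inE.
- by rewrite cardsX cards1 muln1.
Qed.

Lemma card_color_classes (T : {set V * E}) :
  #|T| = \sum_(c : E) #|color_class T c|.
Proof.
rewrite (eq_bigr (fun c => \sum_(v : V) ((v, c) \in T : nat))); last first.
  move=> c _; rewrite -sum1_card big_mkcond.
  by apply: eq_bigr => v _; rewrite inE; case: ifP.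
rewrite exchange_big pair_bigA -sum1_card big_mkcond /=.
by apply: eq_bigr => -[v c] _; case: ifP.
Qed.

End Colors.

(** * List coloring *)

(** A largest face inside [A] is at least as large as the part of [A] in each of
the [t] covering faces. *)
Lemma coverable_big_face (V : finType) (C : complex V) (t : nat) (A : {set V}) :
  coverable C t -> exists S, [/\ S \in C, S \subset A & #|A| <= t * #|S|].
Proof.
move=> [P [/subsetP PC Pcover <-]].
case: (@arg_maxnP _ set0 (fun S => (S \in C) && (S \subset A)) (fun S => #|S|)).
  by rewrite set0_face sub0set.
move=> S /andP[SC SA] Smax; exists S; split=> //.
have -> : A = \bigcup_(F in P) (A :&: F).
  by rewrite -big_distrr /= -[\bigcup_(F in P) F]/(cover P) Pcover setIT.
apply: leq_trans (leq_card_bigcup (mem P) (setI A)) _.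
rewrite -sum_nat_const; apply: leq_sum => F FP; apply: Smax.
by rewrite subsetIl andbT; apply: faces_sub (PC F FP) _; apply: subsetIr.
Qed.

(** The colors in use form the finite type [E], and [X] is the set of the pairs
permitted by the lists. A set of such pairs projecting onto [V] may contain
several pairs over one vertex; keeping one of them preserves faces. *)
Lemma extendible_list_colorable (V : finType) (C : complex V) (k t : nat) :
  0 < k -> extendible k C -> coverable C t -> list_colorable C (k * t).
Proof.
move=> k0 Cext Ct K L cardL.
pose colors := (\big[fsetU/fset0]_(v : V) L v)%fset.
have Lcolors v : {subset L v <= colors}.
  by apply/fsubsetP; apply: bigfcup_sup.
pose E : finType := colors.
pose X := [set x : V * E | fsval x.2 \in L x.1].
have [A A0|T [TD /subsetP TX TV]] :=
  @extendible_transversal _ _ (@fst V E) k (coloring_complex E C) X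
    (@extendible_coloring _ E _ _ Cext).
  (* T collects, for each color c, a face S c containing a fraction 1/t of the
     vertices of A that have c in their list; Y is the set of all pairs over A. *)
  pose Y := over (@fst V E) X A.
  have t0 : 0 < t.
    rewrite lt0n; apply: contraNneq A0 => t0; have [S [_ _]] := coverable_big_face A Ct.
    by rewrite t0 mul0n leqn0 cards_eq0.
  have [S SP] := fin_all_exists (fun c : E => coverable_big_face (color_class Y c) Ct).
  pose T := [set x : V * E | x.1 \in S x.2].
  have TS c : color_class T c = S c by apply/setP => v; rewrite !inE.
  exists T; split.
  - by rewrite inE; apply/forallP => c; rewrite TS; have [] := SP c.
  - apply/subsetP => -[v c]; rewrite inE /=; have [_ /subsetP SY _] := SP c.
    by move=> /SY; rewrite inE.
  - have cardY : #|Y| = #|A| * (k * t).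
      rewrite [RHS](_ : _ = \sum_(v : V) \sum_(c : E) ((v, c) \in Y : nat)).
        rewrite pair_bigA -sum1_card big_mkcond /=.
        by apply: eq_bigr => -[v c] _; case: ifP.
      rewrite -sum_nat_const big_mkcond; apply: eq_bigr => v _.
      case: ifP => vA; last by rewrite big1 // => c _; rewrite !inE /= vA andbF.
      have /card_fsub cardLv : (L v `<=` colors)%fset by apply/fsubsetP/Lcolors.
      rewrite -(cardL v) -cardLv -sum1_card big_mkcond; apply: eq_bigr => c _.
      by rewrite !inE /= vA andbT; case: ifP.
    have Yt : #|Y| <= t * #|T|.
      rewrite !card_color_classes big_distrr /=; apply: leq_sum => c _.
      by rewrite TS; have [] := SP c.
    have kAT : k * #|A| <= #|T|.
      by rewrite -(leq_pmul2l t0) (leq_trans _ Yt) // cardY mulnCA mulnA mulnC mulnA.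
    by rewrite (leq_trans _ kAT) // ltn_pmul2l // prednK // card_gt0.
have TVv v : exists c : E, (v, c) \in T.
  have : v \in [set: V] by []. 
  by rewrite -TV => /imsetP[[w c] wT ->]; exists c.
have [f fT] := fin_all_exists TVv.
exists (fun v => fsval (f v)); split=> [v|c].
  by have := TX _ (fT v); rewrite inE.
have [cE|cE] := boolP (c \in colors).
  move: TD; rewrite inE => /forallP/(_ [` cE]%fset) TC; apply: faces_sub TC _.
  apply/subsetP => v; rewrite !inE => /eqP fv.
  by rewrite (_ : [` cE]%fset = f v) //; apply: val_inj; rewrite /= fv.
(* A color outside all lists has an empty class. *)
apply: faces_sub (set0_face C) _; apply/subsetP => v; rewrite inE => /eqP fv.
by rewrite -fv fsvalP in cE.
Qed.

Theorem theorem5p3 (V : finType) (k : nat) (hk : 1 <= k)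
    (M : 'I_k -> matroid V) (hM : forall i : 'I_k, loopless (indep (M i))) :
  list_chromatic_number (complex_cap (fun i : 'I_k => indep (M i))) <=
    k * chromatic_number (complex_cap (fun i : 'I_k => indep (M i))).
Proof.
set C := complex_cap _.
have Cloopless : loopless C by apply: loopless_complex_cap.
have [Ccov _] := nat_minP (ex_intro _ _ (coverable_card Cloopless)).
have Cext : extendible k C by apply: extendible_cap => i; apply: matroid_extendible.
have Clist := extendible_list_colorable hk Cext Ccov.
by have [_] := nat_minP (ex_intro _ _ Clist); apply.
Qed.
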